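(* Let $n,k,m\ge 1$ be integers, and let $S_1,\dots,S_k$ and $C_1,\dots,C_m$ be nonempty, closed, convex subsets of $\mathbb{R}^n$ with $S_i\cap C_j=\varnothing$ for all $i,j$. Let $Z^*=(x_1^*,\dots,x_k^*,y_1^*,\dots,y_m^* )$ be a feasible point, i.e. $x_i^*\in S_i$ for $i=1,\dots,k$ and $y_j^*\in C_j$ for $j=1,\dots,m$. Then $Z^*$ is an optimal solution of the problem $$\min\ F(x_1,\dots,x_k,y_1,\dots,y_m)=\sum_{i=1}^k\sum_{j=1}^m\|x_i-y_j\|\quad\text{s.t. } x_i\in S_i\ (i=1,\dots,k),\ y_j\in C_j\ (j=1,\dots,m)$$ if and only if there exist normal vectors $n_{S_i}\in N_{S_i}(x_i^* )$ ($i=1,\dots,k$) and $n_{C_j}\in N_{C_j}(y_j^* )$ ($j=1,\dots,m$) satisfying the following conditions: (O1) for each $i=1,\dots,k$, $\displaystyle\sum_{j=1}^m\frac{x_i^*-y_j^*}{\|x_i^*-y_j^*\|}+n_{S_i}=0$; (O2) for each $j=1,\dots,m$, $\displaystyle\sum_{i=1}^k\frac{y_j^*-x_i^*}{\|y_j^*-x_i^*\|}+n_{C_j}=0$; (O3) (obtained by summing (O1) over $i$ and (O2) over $j$) $\displaystyle\sum_{i=1}^k n_{S_i}+\sum_{j=1}^m n_{C_j}=0$.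
   Context: $\|\cdot\|$ and $\langle\cdot,\cdot\rangle$ denote the Euclidean norm and inner product on $\mathbb{R}^n$. For a convex set $C\subset\mathbb{R}^n$ and $x\in C$, the normal cone is $N_C(x):=\{v\in\mathbb{R}^n\mid \langle v,y-x\rangle\le 0\ \ \forall y\in C\}$. *)

(* Defs.v *)
From HB Require Import structures.
From mathcomp Require Import all_boot all_order all_algebra.
From mathcomp Require Import all_classical all_reals all_analysis.

Set Implicit Arguments.
Unset Strict Implicit.
Unset Printing Implicit Defensive.

Import Order.TTheory GRing.Theory Num.Theory.
Import numFieldNormedType.Exports.

Local Open Scope classical_set_scope.
Local Open Scope ring_scope.

Definition dotp (R : realType) (n : nat) (u v : 'rV[R]_n) : R :=
  \sum_(l < n) u 0 l * v 0 l.

(* The library norm `|u| on 'rV[R]_n is the max norm, which induces the same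
   topology but is a different norm; hence this definition. *)
Definition enorm (R : realType) (n : nat) (u : 'rV[R]_n) : R :=
  Num.sqrt (dotp u u).

Definition normal_cone (R : realType) (n : nat) (C : set 'rV[R]_n)
    (x : 'rV[R]_n) : set 'rV[R]_n :=
  [set v | forall y, C y -> dotp v (y - x) <= 0].

Definition total_dist (R : realType) (n k m : nat)
    (x : 'I_k -> 'rV[R]_n) (y : 'I_m -> 'rV[R]_n) : R :=
  \sum_(i < k) \sum_(j < m) enorm (x i - y j).

Definition feasible (R : realType) (n k m : nat)
    (S : 'I_k -> set 'rV[R]_n) (C : 'I_m -> set 'rV[R]_n)
    (x : 'I_k -> 'rV[R]_n) (y : 'I_m -> 'rV[R]_n) : Prop :=
  (forall i, S i (x i)) /\ (forall j, C j (y j)).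

Definition optimal (R : realType) (n k m : nat)
    (S : 'I_k -> set 'rV[R]_n) (C : 'I_m -> set 'rV[R]_n)
    (x : 'I_k -> 'rV[R]_n) (y : 'I_m -> 'rV[R]_n) : Prop :=
  feasible S C x y /\
  forall x' y', feasible S C x' y' -> total_dist x y <= total_dist x' y'.

(* Main.v *)
Require Import Defs.
From HB Require Import structures.
From mathcomp Require Import all_boot all_order all_algebra.
From mathcomp Require Import all_classical all_reals all_analysis.
From mathcomp Require Import ring lra.

Import Order.TTheory GRing.Theory Num.Theory.
Import numFieldNormedType.Exports.

Local Open Scope classical_set_scope.
Local Open Scope ring_scope.

(** With u(a) = a / ||a||, the problem reduces to two elementary estimates:
    ||b|| >= ||a|| + <u(a), b - a> (Cauchy-Schwarz), which gives sufficiency of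
    the conditions after summation over all pairs (i, j), and
    ||a + t d|| <= ||a|| + t <u(a), d> + t^2 ||d||^2 / (2 ||a||) for a <> 0, which
    replaces differentiability of the norm in the proof of necessity: moving one
    point x_i towards z in S_i changes the objective by at most t A + t^2 B with
    A = <sum_j u(x_i - y_j), z - x_i>, so optimality forces A >= 0.  The block of
    the y_j follows by exchanging the two families. *)

(** * Euclidean norm estimates and the first-order condition for a sum of distances *)

Section Dotp.
Context {R : realType} {n : nat}.
Implicit Types (a b c d u v w : 'rV[R]_n) (t : R).

Lemma dotpC u v : dotp u v = dotp v u.
Proof. by apply: eq_bigr => l _; rewrite mulrC. Qed.

Lemma dotpDl u v w : dotp (u + v) w = dotp u w + dotp v w.
Proof. by rewrite -big_split; apply: eq_bigr => l _; rewrite mxE mulrDl. Qed.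

Lemma dotpZl t u v : dotp (t *: u) v = t * dotp u v.
Proof. by rewrite mulr_sumr; apply: eq_bigr => l _; rewrite mxE mulrA. Qed.

Lemma dotpNl u v : dotp (- u) v = - dotp u v.
Proof. by rewrite -scaleN1r dotpZl mulN1r. Qed.

Lemma dotpDr u v w : dotp u (v + w) = dotp u v + dotp u w.
Proof. by rewrite dotpC dotpDl !(dotpC _ u). Qed.

Lemma dotpZr t u v : dotp u (t *: v) = t * dotp u v.
Proof. by rewrite dotpC dotpZl dotpC. Qed.

Lemma dotpNr u v : dotp u (- v) = - dotp u v.
Proof. by rewrite dotpC dotpNl dotpC. Qed.

Lemma dotp0l v : dotp 0 v = 0.
Proof. by rewrite -(scale0r v) dotpZl mul0r. Qed.

Lemma dotp_suml (I : finType) (f : I -> 'rV[R]_n) v :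
  dotp (\sum_i f i) v = \sum_i dotp (f i) v.
Proof.
by elim/big_ind2: _ => [|? ? ? ? <- <-|//]; [exact: dotp0l | exact: dotpDl].
Qed.

Lemma dotp_ge0 u : 0 <= dotp u u.
Proof. by apply: sumr_ge0 => l _; rewrite -expr2 sqr_ge0. Qed.

Lemma dotp_eq0 u : (dotp u u == 0) = (u == 0).
Proof.
apply/eqP/eqP => [|->]; last exact: dotp0l.
move/psumr_eq0P => u0; apply/rowP => l; rewrite mxE.
by apply/eqP; rewrite -[_ == 0]orbb -mulf_eq0 u0 // => i _; rewrite -expr2 sqr_ge0.
Qed.

Lemma enorm_ge0 u : 0 <= enorm u.
Proof. exact: sqrtr_ge0. Qed.

Lemma sqr_enorm u : enorm u ^+ 2 = dotp u u.
Proof. by rewrite sqr_sqrtr ?dotp_ge0. Qed.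

Lemma enorm_gt0 u : u != 0 -> 0 < enorm u.
Proof. by move=> u0; rewrite sqrtr_gt0 lt_def dotp_eq0 u0 dotp_ge0. Qed.

Lemma enormN u : enorm (- u) = enorm u.
Proof. by rewrite /enorm dotpNl dotpNr opprK. Qed.

Lemma dotp_le_enorm a b : dotp a b <= enorm a * enorm b.
Proof.
have [->|a0] := eqVneq a 0; first by rewrite dotp0l mulr_ge0 ?enorm_ge0.
have a_gt0 : 0 < dotp a a by rewrite lt_def dotp_eq0 a0 dotp_ge0.
have [ab0|/ltW ab0] := leP (dotp a b) 0.
  by rewrite (le_trans ab0) ?mulr_ge0 ?enorm_ge0.
rewrite -(@ler_pXn2r _ 2) ?nnegrE ?mulr_ge0 ?enorm_ge0 // exprMn !sqr_enorm.
(* This square expands to [dotp a a] times the Cauchy-Schwarz defect <a,a><b,b> - <a,b>^2. *)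
have := dotp_ge0 (dotp a a *: b - dotp a b *: a).
rewrite !(dotpDl, dotpDr, dotpNl, dotpNr, dotpZl, dotpZr) (dotpC b a).
rewrite -(ler_pM2l a_gt0) -subr_ge0 => h; rewrite -subr_ge0.
by rewrite (le_trans h) // le_eqVlt; apply/orP; left; apply/eqP; ring.
Qed.

(* At [a = 0] the division convention gives [0], still a subgradient of the
   norm. *)
Definition unitv a : 'rV[R]_n := (enorm a)^-1 *: a.

Lemma unitvN a : unitv (- a) = - unitv a.
Proof. by rewrite /unitv enormN scalerN. Qed.

(** The left side collapses to <u(a), b>, since <u(a), a> = ||a||; Cauchy-Schwarz bounds it. *)
Lemma enorm_subgradient a b : enorm a + dotp (unitv a) (b - a) <= enorm b.
Proof.
rewrite /unitv dotpZl dotpDr dotpNr -sqr_enorm.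
have [->|a0] := eqVneq a 0.
  by rewrite /enorm !dotp0l sqrtr0 invr0 mul0r addr0 sqrtr_ge0.
have a_gt0 := enorm_gt0 _ a0; rewrite mulrBr expr2 mulKf ?gt_eqF // addrC subrK.
by rewrite mulrC ler_pdivrMr // mulrC dotp_le_enorm.
Qed.

(** With e = ||a + t d||, the inequality 2 e ||a|| <= ||a||^2 + e^2 divided by 2 ||a|| is the claim,
    once e^2 is expanded. *)
Lemma enorm_quadratic_upper a d t : a != 0 ->
  enorm (a + t *: d) <=
  enorm a + t * dotp (unitv a) d + t ^+ 2 * (dotp d d / (2 * enorm a)).
Proof.
move=> /enorm_gt0 a_gt0; have a_neq0 : enorm a != 0 by rewrite gt_eqF.
have := sqr_ge0 (enorm (a + t *: d) - enorm a).
have := sqr_enorm (a + t *: d).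
rewrite /unitv !(dotpDl, dotpDr, dotpZl, dotpZr) (dotpC d a) -!sqr_enorm.
set e := enorm (a + _) => e2 sq.
rewrite -(ler_pM2l a_gt0) -(@ler_pM2l _ 2) //.
suff -> : 2 * (enorm a * (enorm a + t * ((enorm a)^-1 * dotp a d) +
   t ^+ 2 * (enorm d ^+ 2 / (2 * enorm a)))) = enorm a ^+ 2 + e ^+ 2 by nra.
by rewrite e2; field.
Qed.

Lemma convex_set_segment (K : set 'rV[R]_n) c z t : convex_set K ->
  K c -> K z -> 0 <= t <= 1 -> K (c + t *: (z - c)).
Proof.
move=> Kconv Kc Kz t01.
have t01' : Itv.spec (@Itv.num_sem R) (Itv.Real `[0%Z, 1%Z]) t.
  by rewrite /Itv.spec/= /Itv.num_sem/= in_itv/= realE; case/andP: t01 => -> ->.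
have := Kconv z c (Itv.mk t01'); rewrite !inE => /(_ Kz Kc).
congr K; change (t *: z + (1 - t) *: c = c + t *: (z - c)).
by rewrite scalerBl scale1r scalerBr addrCA addrA.
Qed.

Lemma quadratic_ge0_near0 (A B : R) :
  (forall t, 0 < t <= 1 -> 0 <= t * A + t ^+ 2 * B) -> 0 <= A.
Proof.
move=> AB; rewrite leNgt; apply/negP => A0.
have D0 : 0 < `|B| - A by rewrite ltr_pwDr // oppr_gt0.
(* This t makes t |B| <= - A / 2, hence A + t B <= A / 2 < 0; the denominator stays positive even
   when B = 0. *)
pose t := - A / (`|B| - A) / 2.
have tD : t * (`|B| - A) = - A / 2.
  by rewrite /t; field; rewrite gt_eqF.
have t0 : 0 < t by rewrite !divr_gt0 // oppr_gt0.
have B0 := normr_ge0 B.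
have t1 : t <= 1 by rewrite -(ler_pM2r D0) tD; lra.
have := AB t; rewrite t0 t1 => /(_ isT).
rewrite expr2 -mulrA -mulrDr pmulr_rge0 //.
have := ler_norm B; nra.
Qed.

(** Minimality is tested only at the points c + t (z - c) of a segment in K. As c differs from each
    p_i, every distance has a quadratic upper bound in t, and the sum of these bounds has the
    required linear coefficient. *)
Lemma normal_cone_sum_dist (I : finType) (K : set 'rV[R]_n) (p : I -> 'rV[R]_n) c :
  convex_set K -> K c -> (forall i, c != p i) ->
  (forall z, K z -> \sum_i enorm (c - p i) <= \sum_i enorm (z - p i)) ->
  normal_cone K c (- \sum_i unitv (c - p i)).
Proof.
move=> Kconv Kc cp cmin z Kz; rewrite dotpNl oppr_le0.
apply: (@quadratic_ge0_near0 _
  (\sum_i dotp (z - c) (z - c) / (2 * enorm (c - p i)))) => t /andP[t0 t1].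
rewrite dotp_suml -(lerD2l (\sum_i enorm (c - p i))) addr0.
have Kt : K (c + t *: (z - c)) by apply: convex_set_segment; rewrite // ltW.
apply: le_trans (cmin _ Kt) _.
rewrite !mulr_sumr addrA -!big_split; apply: ler_sum => i _ /=.
by rewrite [X in enorm X <= _]addrAC; apply: enorm_quadratic_upper; rewrite subr_eq0.
Qed.

End Dotp.

(** * The objective over all pairs, and its blocks *)

Section TotalDist.
Context {R : realType} {n k m : nat}.
Implicit Types (x : 'I_k -> 'rV[R]_n) (y : 'I_m -> 'rV[R]_n).
Implicit Types (S : 'I_k -> set 'rV[R]_n) (C : 'I_m -> set 'rV[R]_n).

(** Since u is odd, the two terms belonging to a pair (i, j) merge into <u(x_i - y_j), (x'_i - y'_j)
    - (x_i - y_j)>, so [enorm_subgradient] applies pair by pair. *)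
Lemma total_dist_subgradient x x' y y' :
  total_dist x y + (\sum_i dotp (\sum_j unitv (x i - y j)) (x' i - x i)
                  + \sum_j dotp (\sum_i unitv (y j - x i)) (y' j - y j))
    <= total_dist x' y'.
Proof.
under eq_bigr do rewrite dotp_suml.
under [X in _ + (_ + X)]eq_bigr do rewrite dotp_suml.
rewrite [X in _ + (_ + X)]exchange_big -!big_split; apply: ler_sum => i _ /=.
rewrite -!big_split; apply: ler_sum => j _ /=.
apply: le_trans (enorm_subgradient (x i - y j) _).
rewrite -[y j - x i]opprB unitvN dotpNl -dotpNr -dotpDr.
rewrite (_ : x' i - x i - (y' j - y j) = x' i - y' j - (x i - y j)) //.
by rewrite !opprD addrACA.
Qed.

Lemma optimal_block_min S C x y i z : optimal S C x y -> S i z ->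
  \sum_j enorm (x i - y j) <= \sum_j enorm (z - y j).
Proof.
move=> [[Sx Cy] xymin] Sz.
(* The competitor moves only the i-th point, so all other rows of the double sum cancel. *)
pose x' i' := if i' == i then z else x i'.
have /xymin : feasible S C x' y.
  by split=> // i'; rewrite /x'; case: eqP => [->|].
rewrite /total_dist (bigD1 i) // [leRHS](bigD1 i) //= {1}/x' eqxx.
rewrite (_ : \sum_(i' < k | i' != i) \sum_j enorm (x' i' - y j) =
             \sum_(i' < k | i' != i) \sum_j enorm (x i' - y j)) ?lerD2r //.
by apply: eq_bigr => i' /negPf i'i; rewrite /x' i'i.
Qed.

Lemma optimal_normal_cone S C x y i : convex_set (S i) ->
  (forall j, S i `&` C j = set0) -> optimal S C x y ->
  normal_cone (S i) (x i) (- \sum_j unitv (x i - y j)).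
Proof.
move=> Sconv SC0 opt; have [Sx Cy] := opt.1.
apply: normal_cone_sum_dist => // [j|z Sz]; last exact: optimal_block_min opt Sz.
(* Disjointness keeps x_i away from every y_j, where the norm would have a kink. *)
apply/eqP => xy; suff : set0 (x i) by [].
by rewrite -(SC0 j); split=> //; rewrite xy.
Qed.

End TotalDist.

Lemma total_distC (R : realType) (n k m : nat)
    (x : 'I_k -> 'rV[R]_n) (y : 'I_m -> 'rV[R]_n) :
  total_dist x y = total_dist y x.
Proof.
rewrite /total_dist exchange_big; do 2!apply: eq_bigr => ? _.
by rewrite -enormN opprB.
Qed.

Lemma optimalC {R : realType} {n k m : nat}
    {S : 'I_k -> set 'rV[R]_n} {C : 'I_m -> set 'rV[R]_n}
    {x : 'I_k -> 'rV[R]_n} {y : 'I_m -> 'rV[R]_n} :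
  optimal S C x y -> optimal C S y x.
Proof.
move=> [[Sx Cy] xymin]; split=> // y' x' [Cy' Sx'].
by rewrite total_distC [leRHS]total_distC; apply: xymin.
Qed.

Lemma sum_unitv_antisym (R : realType) (n k m : nat)
    (x : 'I_k -> 'rV[R]_n) (y : 'I_m -> 'rV[R]_n) :
  \sum_i \sum_j unitv (x i - y j) + \sum_j \sum_i unitv (y j - x i) = 0.
Proof.
rewrite [X in _ + X]exchange_big -big_split big1 // => i _ /=.
by rewrite -big_split big1 // => j _ /=; rewrite -[y j - x i]opprB unitvN subrr.
Qed.

Theorem theorem3p6 (R : realType) (n k m : nat)
    (n_gt0 : (0 < n)%N) (k_gt0 : (0 < k)%N) (m_gt0 : (0 < m)%N)
    (S : 'I_k -> set 'rV[R]_n) (C : 'I_m -> set 'rV[R]_n)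
    (S_nonempty : forall i, S i !=set0) (S_closed : forall i, closed (S i))
    (S_convex : forall i, convex_set (S i))
    (C_nonempty : forall j, C j !=set0) (C_closed : forall j, closed (C j))
    (C_convex : forall j, convex_set (C j))
    (SC_disjoint : forall i j, S i `&` C j = set0)
    (x : 'I_k -> 'rV[R]_n) (y : 'I_m -> 'rV[R]_n)
    (xy_feasible : feasible S C x y) :
  optimal S C x y <->
  exists (nS : 'I_k -> 'rV[R]_n) (nC : 'I_m -> 'rV[R]_n),
    (forall i, normal_cone (S i) (x i) (nS i)) /\
    (forall j, normal_cone (C j) (y j) (nC j)) /\
    (forall i,
       \sum_(j < m) (enorm (x i - y j))^-1 *: (x i - y j) + nS i = 0) /\
    (forall j,
       \sum_(i < k) (enorm (y j - x i))^-1 *: (y j - x i) + nC j = 0) /\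
    \sum_(i < k) nS i + \sum_(j < m) nC j = 0.
Proof.
split=> [opt|[nS [nC [NS [NC [sumS [sumC _]]]]]]].
  (* (O1) and (O2) force this choice of normal vectors. *)
  exists (fun i => - \sum_j unitv (x i - y j)).
  exists (fun j => - \sum_i unitv (y j - x i)).
  split=> [i|]; first exact: optimal_normal_cone opt.
  split=> [j|].
    by apply: optimal_normal_cone (optimalC opt) => // i; rewrite setIC.
  split=> [i|]; first by rewrite subrr.
  split=> [j|]; first by rewrite subrr.
  by rewrite !sumrN -opprD sum_unitv_antisym oppr0.
split=> // x' y' [Sx' Cy'].
(* By (O1) and (O2) the sums of unit vectors are - n_S and - n_C, whose products with feasible
   displacements are nonnegative. *)
apply: le_trans (total_dist_subgradient x x' y y'); rewrite lerDl.
apply: addr_ge0; apply: sumr_ge0 => l _.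
  by move/eqP: (sumS l); rewrite addr_eq0 => /eqP ->; rewrite dotpNl oppr_ge0 NS.
by move/eqP: (sumC l); rewrite addr_eq0 => /eqP ->; rewrite dotpNl oppr_ge0 NC.
Qed.
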